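(* Let $1<p<\infty$ and $a_1,a_2>0$. Then $\mathrm{JN}_p^{\mathcal{Q}_{a_1}}(\mathbb{R}^d,\gamma)=\mathrm{JN}_p^{\mathcal{Q}_{a_2}}(\mathbb{R}^d,\gamma)$ algebraically and topologically, that is, the two spaces coincide as sets and their norms are equivalent.
   Context: $\gamma$ is the Gaussian probability measure on $\mathbb{R}^d$, $d\gamma(x)=\pi^{-d/2}e^{-|x|^2}dx$. Cubes are open with sides parallel to the coordinate axes; $c_Q$ and $\ell_Q$ denote the center and side length of a cube $Q$. Let $m(0)=1$ and $m(x)=\min\{1,1/|x|\}$ for $x\neq 0$. For $a>0$, $\mathcal{Q}_a$ is the family of all cubes $Q\subset\mathbb{R}^d$ with $\ell_Q\leq a\,m(c_Q)$. Write $f_Q=\frac{1}{\gamma(Q)}\int_Q f\,d\gamma$. For $a>0$, $1<p<\infty$ and $f\in L^1(\mathbb{R}^d,\gamma)$ put $$K_p^{\mathcal{Q}_a}(f)=\sup\left(\sum_i\gamma(Q_i)\left(\frac{1}{\gamma(Q_i)}\int_{Q_i}|f-f_{Q_i}|\,d\gamma\right)^p\right)^{1/p},$$ the supremum being over all countable collections $\{Q_i\}$ of pairwise disjoint cubes in $\mathcal{Q}_a$. The space $\mathrm{JN}_p^{\mathcal{Q}_a}(\mathbb{R}^d,\gamma)$ consists of all $f\in L^1(\mathbb{R}^d,\gamma)$ with $K_p^{\mathcal{Q}_a}(f)<\infty$, with norm $\|f\|_{\mathrm{JN}_p^{\mathcal{Q}_a}(\mathbb{R}^d,\gamma)}=\|f\|_{L^1(\mathbb{R}^d,\gamma)}+K_p^{\mathcal{Q}_a}(f)$.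 *)

(* Defs.v *)
From HB Require Import structures.
From mathcomp Require Import all_boot all_order all_algebra.
From mathcomp Require Import all_classical all_reals all_analysis.
From mathcomp Require Import measurable_realfun.
Set Implicit Arguments.
Unset Strict Implicit.
Unset Printing Implicit Defensive.
Import Order.TTheory GRing.Theory Num.Theory.
Import numFieldNormedType.Exports.
Local Open Scope classical_set_scope.
Local Open Scope ring_scope.

(* R^n is [n.-tuple R], with the library's product sigma-algebra. *)

Section tcons.
Variables (R : realType) (n : nat).

Definition tcons (z : measurableTypeR R * n.-tuple R) : n.+1.-tuple R :=
  [tuple of z.1 :: z.2].

Lemma measurable_tcons : measurable_fun [set: measurableTypeR R * n.-tuple R] tcons.
Proof. by apply: measurable_cons; [exact: measurable_fst|exact: measurable_snd]. Qed.

HB.instance Definition _ := isMeasurableFun.Build _ _ _ _ tcons measurable_tcons.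

Variable m : {sigma_finite_measure set (n.-tuple R) -> \bar R}.

Definition tcons_measure : set (n.+1.-tuple R) -> \bar R :=
  pushforward (@lebesgue_measure R \x m)%E tcons.

Let tcons_measure0 : tcons_measure set0 = 0%E.
Proof. exact: measure0. Qed.

Let tcons_measure_ge0 A : (0 <= tcons_measure A)%E.
Proof. exact: measure_ge0. Qed.

Let tcons_measure_sigma_additive : semi_sigma_additive tcons_measure.
Proof. exact: measure_semi_sigma_additive. Qed.

HB.instance Definition _ := isMeasure.Build _ _ _ tcons_measure
  tcons_measure0 tcons_measure_ge0 tcons_measure_sigma_additive.

Let tcons_measure_sigma_finite : sigma_finite setT tcons_measure.
Proof.
have /sigma_finiteP[F [TF ndF Foo]] := sigma_finiteT (@lebesgue_measure R).
have /sigma_finiteP[G [TG ndG Goo]] := sigma_finiteT m.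
pose H i := [set t : n.+1.-tuple R | F i (thead t)] `&`
            [set t : n.+1.-tuple R | G i [tuple of behead t]].
have HE i : tcons @^-1` H i = F i `*` G i.
  apply/seteqP; split=> -[x t] /=; rewrite /H /= theadE;
  by rewrite (_ : [tuple of _] = t)//; exact/val_inj.
exists H.
  rewrite predeqE => t; split=> // _.
  have [i _ Fi] : (\bigcup_i F i) (thead t) by rewrite -TF.
  have [j _ Gj] : (\bigcup_i G i) [tuple of behead t] by rewrite -TG.
  exists (maxn i j) => //; split.
  - by have /subsetPset := ndF _ _ (leq_maxl i j); exact.
  - by have /subsetPset := ndG _ _ (leq_maxr i j); exact.
move=> i; have [mF Fi] := Foo i; have [mG Gi] := Goo i; split.
  apply: measurableI; rewrite -[X in measurable X]setTI.
  - exact: (measurable_tnth ord0).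
  - exact: measurable_behead.
rewrite /tcons_measure /pushforward HE.
by rewrite product_measure1E// lte_mul_pinfty// ge0_fin_numE.
Qed.

HB.instance Definition _ := Measure_isSigmaFinite.Build _ _ _ tcons_measure
  tcons_measure_sigma_finite.

End tcons.

(* n-dimensional Lebesgue measure, as an iterated product: R^0 carries the unit
   mass at its only point and R^(n+1) is identified with R * R^n by [tcons]. *)
Fixpoint lebesgue_tuple (R : realType) (n : nat) :
    {sigma_finite_measure set (n.-tuple R) -> \bar R} :=
  match n with
  | 0 => \d_([tuple] : 0.-tuple R)
  | n'.+1 => tcons_measure (lebesgue_tuple R n')
  end.

Definition enorm (R : realType) (n : nat) (x : n.-tuple R) : R :=
  Num.sqrt (\sum_(i < n) tnth x i ^+ 2).

Section gaussian.
Variables (R : realType) (n : nat).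

Definition gauss_pdf (x : n.-tuple R) : R :=
  pi `^ (- (n%:R / 2)) * expR (- enorm x ^+ 2).

Definition gaussian (A : set (n.-tuple R)) : \bar R :=
  (\int[lebesgue_tuple R n]_(x in A) (gauss_pdf x)%:E)%E.

End gaussian.

Section gaussian_probability.
Variable R : realType.

Lemma enorm_sqr n (x : n.-tuple R) : enorm x ^+ 2 = \sum_(i < n) tnth x i ^+ 2.
Proof. by rewrite sqr_sqrtr// sumr_ge0// => i _; rewrite sqr_ge0. Qed.

Lemma gauss_pdf_ge0 n (x : n.-tuple R) : 0 <= gauss_pdf x.
Proof. by rewrite mulr_ge0 ?powR_ge0 ?expR_ge0. Qed.

Lemma measurable_gauss_pdf n : measurable_fun setT (@gauss_pdf R n).
Proof.
apply: measurable_funM => //.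
apply: measurableT_comp => //; apply: measurableT_comp => //.
under eq_fun do rewrite enorm_sqr.
apply: measurable_sum => i; apply: measurable_funX; exact: measurable_tnth.
Qed.

Lemma gauss_pdf_tcons n (z : measurableTypeR R * n.-tuple R) :
  gauss_pdf (tcons z) = (Num.sqrt pi)^-1 * gauss_fun z.1 * gauss_pdf z.2.
Proof.
rewrite /gauss_pdf !enorm_sqr big_ord_recl /tcons tnth0.
under eq_bigr do rewrite tnthS.
rewrite opprD expRD -natr1 mulrDl opprD powRD ?(gt_eqF (pi_gt0 R)) ?implybT//.
rewrite div1r (powRN _ 2^-1) (_ : pi `^ (2^-1) = Num.sqrt pi); last first.
  by rewrite powR12_sqrt ?pi_ge0.
by rewrite /gauss_fun -!mulrA mulrCA; congr (_ * _); rewrite mulrCA.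
Qed.

Lemma integral_gauss_pdf n :
  (\int[lebesgue_tuple R n]_x (gauss_pdf x)%:E = 1)%E.
Proof.
elim: n => [|n IH].
  have mg0 : measurable_fun [set: 0.-tuple R] (fun x => (gauss_pdf x)%:E).
    by apply/measurable_EFinP; exact: measurable_gauss_pdf.
  rewrite /= integral_dirac//.
  by rewrite diracT mul1e /gauss_pdf enorm_sqr big_ord0 mul0r oppr0 powRr0 expR0 mulr1.
have mg : measurable_fun [set: n.+1.-tuple R] (fun x => (gauss_pdf x)%:E).
  by apply/measurable_EFinP; exact: measurable_gauss_pdf.
have mg1 : measurable_fun setT (fun x : measurableTypeR R => (gauss_fun x)%:E).
  by apply/measurable_EFinP; exact: measurable_gauss_fun.
have pi0 : Num.sqrt (pi : R) != 0 by rewrite gt_eqF// sqrtr_gt0 pi_gt0.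
rewrite [lebesgue_tuple R n.+1]/= /tcons_measure ge0_integral_pushforward//; last first.
  by move=> x _; rewrite lee_fin gauss_pdf_ge0.
rewrite preimage_setT fubini_tonelli1/=; last 2 first.
- by apply: (measurableT_comp mg); apply: measurable_tcons.
- by move=> z; rewrite lee_fin gauss_pdf_ge0.
transitivity (\int[@lebesgue_measure R]_x
    (((Num.sqrt pi)^-1)%:E * (gauss_fun x)%:E))%E.
  apply: eq_integral => x _; rewrite /fubini_F.
  under eq_integral do rewrite /= gauss_pdf_tcons EFinM.
  rewrite /= ge0_integralZl//=; last 3 first.
  - by apply/measurable_EFinP; exact: measurable_gauss_pdf.
  - by move=> y _; rewrite lee_fin gauss_pdf_ge0.
  - by rewrite lee_fin mulr_ge0 ?invr_ge0 ?sqrtr_ge0 ?gauss_fun_ge0.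
  by rewrite IH mule1 EFinM.
rewrite ge0_integralZl//=; last first.
  by move=> y _; rewrite lee_fin gauss_fun_ge0.
by rewrite integralT_gauss -EFinM mulVf.
Qed.

Variable n : nat.
Let gaussian0 : @gaussian R n set0 = 0%E.
Proof. exact: integral_set0. Qed.

Let gaussian_ge0 A : (0 <= @gaussian R n A)%E.
Proof. by apply: integral_ge0 => x _; rewrite lee_fin gauss_pdf_ge0. Qed.

Let gaussian_sigma_additive : semi_sigma_additive (@gaussian R n).
Proof.
move=> F mF tF mUF; rewrite /gaussian ge0_integral_bigcup//=; last 2 first.
- by apply/measurable_EFinP; apply: measurable_funTS; exact: measurable_gauss_pdf.
- by move=> x _; rewrite lee_fin gauss_pdf_ge0.
apply: is_cvg_ereal_nneg_natsum_cond => k _ _.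
exact: gaussian_ge0.
Qed.

HB.instance Definition _ := isMeasure.Build _ _ _ (@gaussian R n)
  gaussian0 gaussian_ge0 gaussian_sigma_additive.

Let gaussian_setT : @gaussian R n setT = 1%E.
Proof. exact: integral_gauss_pdf. Qed.

HB.instance Definition _ := Measure_isProbability.Build _ _ _ (@gaussian R n)
  gaussian_setT.

End gaussian_probability.

Section john_nirenberg.
Variables (R : realType) (d : nat).
Local Notation gamma := (@gaussian R d).
Implicit Types (x c : d.-tuple R) (Q : set (d.-tuple R)) (f : d.-tuple R -> R).

Definition cube c (l : R) : set (d.-tuple R) :=
  [set x | forall i, tnth x i \in `]tnth c i - l / 2, tnth c i + l / 2[].

(* The case split is needed: [0^-1] is [0] in the library. *)
Definition gscale x : R :=
  if x == [tuple 0 | i < d] then 1 else Num.min 1 (enorm x)^-1.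

Definition cubes (a : R) : set (set (d.-tuple R)) :=
  [set Q | exists c l, [/\ Q = cube c l, 0 < l & l <= a * gscale c]].

Definition gmean f Q : R := (fine (gamma Q))^-1 * \int[gamma]_(x in Q) f x.

Definition goscillation f Q : R := gmean (fun x => `|f x - gmean f Q|) Q.

Definition JN_packing (a : R) : set (set (set (d.-tuple R))) :=
  [set C | [/\ countable C, C `<=` cubes a & trivIset C id]].

Definition JN_const (p a : R) f : \bar R :=
  ereal_sup [set ((\esum_(Q in C) (gamma Q * (goscillation f Q `^ p)%:E))
                    `^ p^-1)%E | C in JN_packing a].

(* Elements are functions rather than classes modulo a.e. equality; neither
   [JN_const] nor the L^1 norm changes on a null set. *)
Definition JN (p a : R) : set (d.-tuple R -> R) :=
  [set f | f \in Lfun gamma 1%E /\ (JN_const p a f < +oo)%E].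

Definition JN_norm (p a : R) f : \bar R :=
  ('N[gamma]_1[EFin \o f] + JN_const p a f)%E.

End john_nirenberg.

(* Main.v *)
(* On an admissible cube [Q] of parameter [b] the function [|x|^2] oscillates
   by at most a constant, so the Gaussian density is comparable to a constant
   on [Q] and [gamma] is doubling on the subcubes of [Q].  Cover a cube by its
   corner subcubes of ratio 2/3, which all contain the middle third: the
   oscillation on the cube is controlled by the largest one on a corner.
   Iterating a fixed number of times yields a single subcube of [Q], admissible
   for [a], whose oscillation and measure dominate those of [Q] up to constants.
   Since only one subcube is selected in each [Q], a disjoint family is sent
   injectively to a disjoint family, and the suprema compare directly. *)

Require Import Defs.
From mathcomp Require Import all_boot all_order all_algebra.
From mathcomp Require Import all_classical all_reals all_analysis.
From mathcomp Require Import measurable_realfun.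
From mathcomp Require Import ring lra.
Import Order.TTheory GRing.Theory Num.Theory.
Local Open Scope classical_set_scope.
Local Open Scope ring_scope.
Set Implicit Arguments.
Unset Strict Implicit.

Lemma esumZl (R : realType) (T : choiceType) (S : set T) (a : T -> \bar R) (r : R) :
  0 <= r -> (forall x, 0 <= a x)%E ->
  (\esum_(x in S) (r%:E * a x) = r%:E * \esum_(x in S) a x)%E.
Proof.
move=> r0 a0; rewrite /esum -ereal_supZl//; last first.
  by apply/set0P; exists (\sum_(x \in set0) a x)%E; exists set0 => //; split.
congr ereal_sup; rewrite image_comp; apply: eq_imagel => A [finA AS] /=.
by rewrite ge0_mule_fsumr.
Qed.

(** * Integrals over covers and subsets *)

Section cover.
Context d (T : measurableType d) (R : realType) (mu : {measure set T -> \bar R}).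

(** Each point of [Q] lies in some piece and [g] is nonnegative, so the cut-offs of [g] to the
    pieces, which may overlap, add up pointwise to at least [g]. *)
Lemma le_Rintegral_cover (I : finType) (F : I -> set T) (Q : set T) (g : T -> R) :
  measurable Q -> (forall i, measurable (F i)) -> (forall i, F i `<=` Q) ->
  (forall x, Q x -> exists i, F i x) ->
  mu.-integrable Q (EFin \o g) -> (forall x, 0 <= g x) ->
  \int[mu]_(x in Q) g x <= \sum_i \int[mu]_(x in F i) g x.
Proof.
move=> mQ mF FQ QF ig g0.
have iF i : mu.-integrable (F i) (EFin \o g) by exact: integrableS (FQ i) ig.
rewrite -lee_fin -sumEFin /Rintegral fineK; last exact: integrable_fin_num.
rewrite (eq_bigr (fun i => \int[mu]_(x in F i) (EFin \o g) x)%E); last first.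
  by move=> i _; rewrite fineK//; exact: integrable_fin_num.
have mg := measurable_int _ ig.
have mgF i : measurable_fun Q ((EFin \o g) \_ (F i) : T -> \bar R).
  by apply/measurable_restrict => //; apply: measurable_funS mg.
have gF0 i x : (0 <= ((EFin \o g) \_ (F i)) x)%E.
  by rewrite patchE; case: ifPn => //= _; rewrite lee_fin.
(* Each integral over [F i] becomes one over [Q] of the cut-off of [g], so that the sum can move
   under a single integral. *)
under eq_bigr => i _.
  rewrite -{1}(setIidr (FQ i)) integral_mkcondr.
  over.
rewrite -ge0_integral_sum//.
apply: ge0_le_integral => //.
- by move=> x _; rewrite lee_fin.
- by apply: emeasurable_sum => i; exact: mgF.
move=> x Qx; have [i Fix] := QF x Qx.
rewrite (bigD1 i)//= {1}patchE mem_set// leeDl//; exact: sume_ge0.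
Qed.

Lemma Rintegral_subset (A B : set T) (g : T -> R) :
  measurable A -> measurable B -> A `<=` B ->
  mu.-integrable B (EFin \o g) -> (forall x, 0 <= g x) ->
  \int[mu]_(x in A) g x <= \int[mu]_(x in B) g x.
Proof.
move=> mA mB AB ig g0.
have iA : mu.-integrable A (EFin \o g) by exact: integrableS AB ig.
rewrite -lee_fin /Rintegral !fineK; try exact: integrable_fin_num.
apply: ge0_subset_integral => //; first exact: measurable_int ig.
by move=> x _; rewrite lee_fin.
Qed.

End cover.

(** * Means and oscillations for the Gaussian measure *)

Section oscillation.
Variables (R : realType) (n : nat).
Local Notation gamma := (@gaussian R n).
Implicit Types (A B Q S : set (n.-tuple R)) (f : n.-tuple R -> R).

Lemma gamma_fin_num A : measurable A -> gamma A \is a fin_num.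
Proof. by move=> mA; exact: fin_num_measure. Qed.

Lemma integrable_normB A f c : measurable A ->
  gamma.-integrable A (EFin \o f) ->
  gamma.-integrable A (EFin \o (fun x => `|f x - c|)).
Proof.
move=> mA fi.
have ci : gamma.-integrable A (EFin \o cst c).
  by apply: finite_measure_integrable_cst.
exact: (integrable_norm (integrableB mA fi ci)).
Qed.

Lemma gmeanE f Q : measurable Q -> 0 < fine (gamma Q) ->
  fine (gamma Q) * gmean f Q = \int[gamma]_(x in Q) f x.
Proof. by move=> mQ Q0; rewrite mulrA divff ?mul1r// gt_eqF. Qed.

Lemma gmean_ge0 f Q : (forall x, 0 <= f x) -> 0 <= gmean f Q.
Proof.
move=> f0; apply: mulr_ge0; first by rewrite invr_ge0 fine_ge0.
by apply: Rintegral_ge0 => x _; exact: f0.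
Qed.

(** The difference on the left is the mean of [f - c], to which the triangle inequality for
    integrals applies. *)
Lemma gmean_dist f Q c : measurable Q -> 0 < fine (gamma Q) ->
  gamma.-integrable Q (EFin \o f) ->
  `|gmean f Q - c| <= gmean (fun x => `|f x - c|) Q.
Proof.
move=> mQ Q0 fi.
have ci : gamma.-integrable Q (EFin \o cst c).
  by apply: finite_measure_integrable_cst.
have -> : gmean f Q - c = (fine (gamma Q))^-1 * \int[gamma]_(x in Q) (f x - c).
  rewrite RintegralB// Rintegral_cst// mulrBr -/(gmean f Q).
  by rewrite mulrCA mulVf ?mulr1// gt_eqF.
have V0 : 0 <= (fine (gamma Q))^-1 by rewrite invr_ge0 ltW.
rewrite normrM ger0_norm// /gmean ler_wpM2l//.
by apply: le_normr_Rintegral => //; exact: (integrableB mQ fi ci).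
Qed.

Lemma le_gmean_normB f Q c c' : measurable Q -> 0 < fine (gamma Q) ->
  gamma.-integrable Q (EFin \o f) ->
  gmean (fun x => `|f x - c|) Q <= gmean (fun x => `|f x - c'|) Q + `|c' - c|.
Proof.
move=> mQ Q0 fi.
have ci r : gamma.-integrable Q (EFin \o cst r).
  by apply: finite_measure_integrable_cst.
rewrite -(ler_pM2l Q0) mulrDr !gmeanE// mulrC -Rintegral_cst//.
rewrite -(RintegralD mQ (integrable_normB c' mQ fi) (ci _)).
apply: le_Rintegral => //.
- exact: integrable_normB.
- exact: (integrableD mQ (integrable_normB c' mQ fi) (ci _)).
- by move=> x _; rewrite -(subrK c' (f x)) -addrA !addrNK ler_normD.
Qed.

(** The mean is optimal up to a factor 2 among centering constants: moving from [c] to the mean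
    costs the distance between them, which [gmean_dist] bounds by the mean of [|f - c|] itself. *)
Lemma goscillation_le_normB f Q c : measurable Q -> 0 < fine (gamma Q) ->
  gamma.-integrable Q (EFin \o f) ->
  goscillation f Q <= 2 * gmean (fun x => `|f x - c|) Q.
Proof.
move=> mQ Q0 fi.
apply: (le_trans (le_gmean_normB (gmean f Q) c mQ Q0 fi)).
by rewrite mulrDl mul1r lerD2l distrC gmean_dist.
Qed.

Lemma goscillation_ge0 f Q : 0 <= goscillation f Q.
Proof. exact: gmean_ge0. Qed.

(* Every piece contains the common core [S], so its mean of [f] is within
   [D] times its oscillation of the mean over [S]. *)
Lemma goscillation_cover (I : finType) (i0 : I) (F : I -> set (n.-tuple R))
    Q S f D :
  measurable Q -> measurable S -> (forall i, measurable (F i)) ->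
  (forall i, S `<=` F i) -> (forall i, F i `<=` Q) ->
  (forall x, Q x -> exists i, F i x) ->
  0 < fine (gamma S) -> fine (gamma Q) <= D * fine (gamma S) ->
  gamma.-integrable Q (EFin \o f) ->
  exists i, goscillation f Q <= 2 * #|I|%:R * (1 + D) * goscillation f (F i).
Proof.
move=> mQ mS mF SF FQ QF S0 QS fi.
have lefine A B : measurable A -> measurable B -> A `<=` B ->
    fine (gamma A) <= fine (gamma B).
  move=> mA mB AB; rewrite fine_le ?gamma_fin_num//.
  by apply: le_measure => //; rewrite inE.
have F0 i : 0 < fine (gamma (F i)) by apply: lt_le_trans S0 _; exact: lefine.
have Q0 : 0 < fine (gamma Q) by apply: lt_le_trans (F0 i0) _; exact: lefine.
have Fi i : gamma.-integrable (F i) (EFin \o f) by exact: integrableS (FQ i) fi.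
have Si : gamma.-integrable S (EFin \o f) by exact: integrableS (SF i0) (Fi i0).
have D0 : 0 <= D.
  by rewrite -(pmulr_lge0 _ S0) (le_trans _ QS)// ltW.
(* The witness is the piece of largest oscillation; [i0] guarantees that there is a piece. *)
have [i _ imax] : extremum_spec >=%O xpredT (fun i => goscillation f (F i))
    [arg max_(i > i0) goscillation f (F i)]%O.
  by apply: arg_maxP.
exists i; set M := goscillation f (F i) in imax *.
set m := gmean f S.
(* Averaging [|f - gmean f (F j)|] over [S] instead of [F j] costs at most the ratio of the
   measures, which is at most [D] since [F j] lies in [Q]. *)
have mSF j : `|gmean f (F j) - m| <= D * M.
  rewrite distrC; apply: (le_trans (gmean_dist (gmean f (F j)) mS S0 Si)).
  rewrite -(ler_pM2l S0) gmeanE//.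
  apply: (@le_trans _ _ (\int[gamma]_(x in F j) `|f x - gmean f (F j)|)).
    by apply: Rintegral_subset => //; exact: integrable_normB.
  rewrite -gmeanE//.
  have -> : fine (gamma S) * (D * M) = (D * fine (gamma S)) * M by ring.
  apply: ler_pM; [exact: ltW|exact: goscillation_ge0| |exact: imax].
  by rewrite (le_trans _ QS)//; exact: lefine.
have piece j : \int[gamma]_(x in F j) `|f x - m| <= fine (gamma Q) * ((1 + D) * M).
  rewrite -gmeanE//; apply: ler_pM; [exact: ltW|exact: gmean_ge0|exact: lefine|].
  apply: (le_trans (le_gmean_normB m (gmean f (F j)) (mF j) (F0 j) (Fi j))).
  by rewrite mulrDl mul1r; apply: lerD; [exact: imax|exact: mSF].
(* In the final constant, 2 comes from centering at the mean over [S], [#|I|] from summing over the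
   pieces, and [1 + D] from the bound [piece] on each of them. *)
apply: (le_trans (goscillation_le_normB m mQ Q0 fi)).
have -> : 2 * #|I|%:R * (1 + D) * M = 2 * (#|I|%:R * ((1 + D) * M)) by ring.
rewrite ler_pM2l// -(ler_pM2l Q0) gmeanE//.
apply: (le_trans (le_Rintegral_cover mQ mF FQ QF (integrable_normB m mQ fi) _)) => //.
apply: (@le_trans _ _ (\sum_(j : I) fine (gamma Q) * ((1 + D) * M))).
  by apply: ler_sum => j _; exact: piece.
by rewrite sumr_const [leRHS]mulrCA mulr_natl.
Qed.

End oscillation.

(** * Cubes: measurability and Lebesgue measure *)

Section cubes.
Variables (R : realType) (n : nat).
Implicit Types (c x y : n.-tuple R) (l : R).

Lemma cubeP c l x :
  cube c l x <-> forall i, tnth c i - l / 2 < tnth x i < tnth c i + l / 2.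
Proof. by split=> h i; have := h i; rewrite in_itv. Qed.

Lemma measurable_cube c l : measurable (cube c l).
Proof.
have -> : cube c l = \bigcap_(i in [set: 'I_n])
    ((fun x : n.-tuple R => tnth x i) @^-1`
      [set` `]tnth c i - l / 2, tnth c i + l / 2[]).
  by apply/seteqP; split=> x /= h i; [move=> _|]; exact: h.
apply: fin_bigcap_measurable => // i _; rewrite -[X in measurable X]setTI.
exact: measurable_tnth.
Qed.

Lemma cube_center c l : 0 < l -> cube c l c.
Proof. by move=> l0; apply/cubeP => i; lra. Qed.

End cubes.

(** By induction on the dimension: through [tcons] a cube is the product of an interval of length
    [l] and a cube of one dimension less. In dimension 0 the cube is the whole one-point space, of
    mass 1. *)
Lemma lebesgue_tuple_cube (R : realType) n (c : n.-tuple R) l : 0 < l ->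
  lebesgue_tuple R n (cube c l) = (l ^+ n)%:E.
Proof.
move=> l0; elim: n c => [|n IH] c.
  rewrite expr0 /= diracE mem_set//.
  by apply/cubeP; case.
case/tupleP: c => c0 c.
rewrite /= /tcons_measure /pushforward.
have -> : @tcons R n @^-1` cube [tuple of c0 :: c] l =
    [set` `]c0 - l / 2, c0 + l / 2[] `*` cube c l.
  apply/seteqP; split=> -[x0 x] /=.
    move=> h; split; first by have := h ord0; rewrite !tnth0.
    by move=> i; have := h (lift ord0 i); rewrite !tnthS.
  move=> [h0 h] i; case: (unliftP ord0 i) => [j|] ->.
    by rewrite !tnthS; exact: h.
  by rewrite !tnth0.
rewrite product_measure1E//; last exact: measurable_cube.
rewrite [X in (X * _)%E]lebesgue_measure_itv/= lte_fin ifT; last by lra.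
rewrite [X in (_ * X)%E]IH -EFinB -EFinM exprS; congr (_ * _)%:E; lra.
Qed.

(** * Doubling and passage to a smaller cube *)

Section doubling.
Variables (R : realType) (n : nat).
Local Notation gamma := (@gaussian R n).
Implicit Types (c x y : n.-tuple R) (l E : R).

Lemma gauss_pdf_gt0 x : 0 < gauss_pdf x.
Proof. by rewrite mulr_gt0 ?expR_gt0// powR_gt0// pi_gt0. Qed.

Lemma measurable_gauss_pdfE (D : set (n.-tuple R)) :
  measurable_fun D (fun x : n.-tuple R => (gauss_pdf x)%:E).
Proof.
by apply/measurable_EFinP; apply: measurable_funTS; exact: measurable_gauss_pdf.
Qed.

Lemma gaussian_cube_le c l k : 0 < l -> 0 <= k ->
  (forall x, cube c l x -> gauss_pdf x <= k) ->
  fine (gamma (cube c l)) <= k * l ^+ n.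
Proof.
move=> l0 k0 kP; rewrite -lee_fin fineK; last first.
  exact: gamma_fin_num (measurable_cube _ _).
rewrite EFinM -(lebesgue_tuple_cube c l0) -integral_cst; last first.
  exact: measurable_cube.
apply: ge0_le_integral => //.
- exact: measurable_cube.
- by move=> x _; rewrite lee_fin gauss_pdf_ge0.
- exact: measurable_gauss_pdfE.
Qed.

Lemma gaussian_cube_ge c l k : 0 < l -> 0 <= k ->
  (forall x, cube c l x -> k <= gauss_pdf x) ->
  k * l ^+ n <= fine (gamma (cube c l)).
Proof.
move=> l0 k0 kP; rewrite -lee_fin fineK; last first.
  exact: gamma_fin_num (measurable_cube _ _).
rewrite EFinM -(lebesgue_tuple_cube c l0) -integral_cst; last first.
  exact: measurable_cube.
apply: ge0_le_integral => //.
- exact: measurable_cube.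
- exact: measurable_gauss_pdfE.
Qed.

(** A Harnack-type condition on the density, stated without infimum or supremum so that it passes to
    subsets with the same [E]. *)
Definition gauss_comparable E (Q : set (n.-tuple R)) :=
  forall x y, Q x -> Q y -> gauss_pdf x <= E * gauss_pdf y.

Lemma gauss_comparable_subset E (A B : set (n.-tuple R)) :
  A `<=` B -> gauss_comparable E B -> gauss_comparable E A.
Proof. by move=> AB BE x y /AB Bx /AB By; exact: BE. Qed.

Lemma subset_cube_concentric c l l' : l' <= l -> cube c l' `<=` cube c l.
Proof. by move=> ll x /cubeP h; apply/cubeP => i; have := h i; lra. Qed.

Lemma gaussian_cube_gt0 c l : 0 < l -> forall E, 0 < E ->
  gauss_comparable E (cube c l) -> 0 < fine (gamma (cube c l)).
Proof.
move=> l0 E E0 QE.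
apply: (@lt_le_trans _ _ (E^-1 * gauss_pdf c * l ^+ n)).
  by rewrite mulr_gt0 ?exprn_gt0// mulr_gt0 ?invr_gt0// gauss_pdf_gt0.
apply: gaussian_cube_ge => //.
  by rewrite mulr_ge0 ?gauss_pdf_ge0// invr_ge0 ltW.
move=> x Qx; rewrite ler_pdivrMl//.
by apply: QE => //; exact: cube_center.
Qed.

(** Compare the density with its value at the center: at most [E] times it on the cube, at least
    [E^-1] times it on the middle third. The Lebesgue measures contribute the factor [3 ^+ n]. *)
Lemma gaussian_cube_doubling c l E : 0 < l -> 0 < E ->
  gauss_comparable E (cube c l) ->
  fine (gamma (cube c l)) <= E ^+ 2 * 3 ^+ n * fine (gamma (cube c (l / 3))).
Proof.
move=> l0 E0 QE.
have Qc := cube_center c l0.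
have l30 : 0 < l / 3 by rewrite divr_gt0.
apply: (@le_trans _ _ (E * gauss_pdf c * l ^+ n)).
  apply: gaussian_cube_le => //; first by rewrite mulr_ge0 ?gauss_pdf_ge0// ltW.
  by move=> x Qx; exact: QE.
have -> : E * gauss_pdf c * l ^+ n =
    E ^+ 2 * 3 ^+ n * (E^-1 * gauss_pdf c * (l / 3) ^+ n).
  rewrite expr_div_n; field.
  by rewrite expf_neq0// gt_eqF.
rewrite ler_pM2l; last by rewrite mulr_gt0 ?exprn_gt0.
apply: gaussian_cube_ge => //.
  by rewrite mulr_ge0 ?gauss_pdf_ge0// invr_ge0 ltW.
move=> x Sx; rewrite ler_pdivrMl//; apply: QE => //.
by apply: subset_cube_concentric Sx; lra.
Qed.

(** This is [goscillation_cover] for the corner subcubes, indexed by sign vectors, with the middle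
    third as core and [D] the doubling constant. *)
Lemma goscillation_subcube (f : n.-tuple R -> R) c l E :
  0 < l -> 0 < E -> gauss_comparable E (cube c l) ->
  gamma.-integrable [set: n.-tuple R] (EFin \o f) ->
  let D := E ^+ 2 * 3 ^+ n in
  exists c', [/\ cube c' (2 / 3 * l) `<=` cube c l,
    goscillation f (cube c l) <=
      2 * #|{ffun 'I_n -> bool}|%:R * (1 + D) * goscillation f (cube c' (2 / 3 * l)) &
    fine (gamma (cube c l)) <= D * fine (gamma (cube c' (2 / 3 * l)))].
Proof.
move=> l0 E0 QE fi D.
(* A shift by [l / 6] with half side [l / 3] spans, in each coordinate, from the far edge of the
   middle third to an edge of the cube: [(-l/6, l/2)] or [(-l/2, l/6)] relative to the center. *)
pose corner (s : {ffun 'I_n -> bool}) : n.-tuple R :=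
  [tuple tnth c i + (-1) ^+ s i * (l / 6) | i < n].
have cornerE s i : tnth (corner s) i = tnth c i + (-1) ^+ s i * (l / 6).
  by rewrite tnth_mktuple.
have SF s : cube c (l / 3) `<=` cube (corner s) (2 / 3 * l).
  move=> x /cubeP h; apply/cubeP => i; rewrite cornerE; have := h i.
  by case: (s i); rewrite ?expr1 ?expr0; lra.
have FQ s : cube (corner s) (2 / 3 * l) `<=` cube c l.
  move=> x /cubeP h; apply/cubeP => i; have := h i; rewrite cornerE.
  by case: (s i); rewrite ?expr1 ?expr0; lra.
have QF x : cube c l x -> exists s, cube (corner s) (2 / 3 * l) x.
  (* The value [true] gives the sign -1, so each coordinate is shifted towards the side where [x]
     lies. *)
  move=> /cubeP h; exists [ffun i => tnth x i <= tnth c i].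
  apply/cubeP => i; rewrite cornerE ffunE; have := h i.
  by case: (leP (tnth x i) (tnth c i)) => hx; rewrite ?expr1 ?expr0; lra.
have mc c0 l1 : measurable (cube (c0 : n.-tuple R) l1) by exact: measurable_cube.
have l30 : 0 < l / 3 by rewrite divr_gt0.
have S0 : 0 < fine (gamma (cube c (l / 3))).
  apply: (@gaussian_cube_gt0 _ _ _ E) => //.
  by apply: gauss_comparable_subset QE; apply: subset_cube_concentric; lra.
have fQ : gamma.-integrable (cube c l) (EFin \o f) by exact: integrableS fi.
have dbl := gaussian_cube_doubling l0 E0 QE.
have [s Hs] := goscillation_cover [ffun=> true] (mc _ _) (mc _ _)
  (fun s => mc _ _) SF FQ QF S0 dbl fQ.
exists (corner s); split => //.
apply: (le_trans dbl); apply: ler_wpM2l.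
  by rewrite mulr_ge0 ?exprn_ge0// ltW.
rewrite fine_le ?gamma_fin_num//.
by apply: le_measure; rewrite ?inE//; exact: SF.
Qed.

(** Comparability with the same [E] is inherited by each selected subcube, so every step costs the
    same factors and the constants are plain powers. *)
Lemma goscillation_subcube_iter k (f : n.-tuple R -> R) c l E :
  0 < l -> 0 < E -> gauss_comparable E (cube c l) ->
  gamma.-integrable [set: n.-tuple R] (EFin \o f) ->
  let D := E ^+ 2 * 3 ^+ n in
  exists c', [/\ cube c' ((2 / 3) ^+ k * l) `<=` cube c l,
    goscillation f (cube c l) <= (2 * #|{ffun 'I_n -> bool}|%:R * (1 + D)) ^+ k
      * goscillation f (cube c' ((2 / 3) ^+ k * l)) &
    fine (gamma (cube c l)) <= D ^+ k * fine (gamma (cube c' ((2 / 3) ^+ k * l)))].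
Proof.
move=> l0 E0 QE fi D.
have D0 : 0 <= D by rewrite mulr_ge0 ?exprn_ge0// ltW.
elim: k => [|k [c1 [Q1 o1 g1]]].
  by exists c; rewrite !expr0 !mul1r; split.
have l10 : 0 < (2 / 3) ^+ k * l by rewrite mulr_gt0// exprn_gt0// divr_gt0.
have [c2 []] := goscillation_subcube l10 E0 (gauss_comparable_subset Q1 QE) fi.
rewrite mulrA -exprS => Q2 o2 g2; exists c2; split.
- exact: subset_trans Q2 Q1.
- apply: (le_trans o1); rewrite [X in _ <= X * _]exprSr -[leRHS]mulrA.
  apply: ler_wpM2l => //; apply: exprn_ge0.
  by apply: mulr_ge0; [rewrite mulr_ge0|rewrite addr_ge0].
- apply: (le_trans g1); rewrite [X in _ <= X * _]exprSr -[leRHS]mulrA.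
  by apply: ler_wpM2l => //; exact: exprn_ge0.
Qed.

End doubling.

(** * Admissible cubes and the scale function *)

Section scale.
Variables (R : realType) (n : nat).
Local Notation gamma := (@gaussian R n).
Implicit Types (c x y : n.-tuple R) (l a b : R).

(** This form removes the case split at the origin and turns admissibility into
    [l * Num.max 1 (enorm c) <= b]. *)
Lemma gscaleE x : gscale x = (Num.max 1 (enorm x))^-1.
Proof.
rewrite /gscale; case: eqP => [->|/eqP x0].
  have -> : enorm [tuple (0 : R) | i < n] = 0.
    rewrite /enorm big1 ?sqrtr0// => i _.
    by rewrite tnth_mktuple expr0n.
  by rewrite max_l ?invr1.
have e0 : 0 < enorm x.
  rewrite sqrtr_gt0 lt_def sumr_ge0 ?andbT; last by move=> i _; exact: sqr_ge0.
  apply: contra x0; rewrite psumr_eq0; last by move=> i _; exact: sqr_ge0.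
  move=> /allP xi0; apply/eqP/eq_from_tnth => i.
  have := xi0 i (mem_index_enum i).
  by rewrite /= sqrf_eq0 => /eqP ->; rewrite tnth_mktuple.
case: (leP 1 (enorm x)) => e1.
  by rewrite min_r// invf_le1.
by rewrite min_l ?invr1// invf_ge1// ltW.
Qed.

Lemma max1_enorm_sqr x : enorm x ^+ 2 <= Num.max 1 (enorm x) ^+ 2.
Proof. by rewrite lerXn2r ?nnegrE ?le_max ?sqrtr_ge0 ?ler01// lexx orbT. Qed.

Lemma tnth_le_max1_enorm x i : `|tnth x i| <= Num.max 1 (enorm x).
Proof.
rewrite le_max; apply/orP; right.
rewrite -(ler_pXn2r (ltn0Sn 1)) ?nnegrE ?sqrtr_ge0// enorm_sqr real_normK ?num_real//.
by rewrite (bigD1 i)//= lerDl sumr_ge0// => j _; exact: sqr_ge0.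
Qed.

Section admissible.
Variables (b l : R) (c : n.-tuple R).
Hypotheses (l0 : 0 < l) (lb : l <= b * gscale c).
Local Notation M := (Num.max 1 (enorm c)).

Let M1 : 1 <= M. Proof. by rewrite le_max lexx. Qed.

Let lM : l * M <= b.
Proof. by move: lb; rewrite gscaleE ler_pdivlMr// (lt_le_trans ltr01). Qed.

Let leb : l <= b.
Proof. by rewrite (le_trans _ lM)// ler_peMr// ltW. Qed.

(** The scale at any point of an admissible cube is bounded below by a fixed multiple of the scale
    at its center. Coordinatewise, [|x_i - c_i| <= b / 2] gives [x_i^2 <= 2 c_i^2 + b^2]. *)
Lemma max1_enorm_cube x : cube c l x ->
  Num.max 1 (enorm x) <= (2 + n%:R * b ^+ 2) * M.
Proof.
move=> /cubeP xc.
have K2 : 2 <= 2 + n%:R * b ^+ 2 by rewrite lerDl mulr_ge0// sqr_ge0.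
have K0 : 0 <= 2 + n%:R * b ^+ 2 by lra.
have M0 : 0 <= M by exact: le_trans M1.
have := max1_enorm_sqr c; move: M0 (M1); move: M => m m0 m1 em.
rewrite ge_max; apply/andP; split; first by nra.
rewrite -(ler_pXn2r (ltn0Sn 1)) ?nnegrE ?sqrtr_ge0 ?mulr_ge0// enorm_sqr.
apply: (@le_trans _ _ (\sum_(i < n) (2 * tnth c i ^+ 2 + b ^+ 2))).
  apply: ler_sum => i _; have := xc i; move: (tnth x i) (tnth c i) => u v uv.
  have h1 : 0 <= (b / 2 - (u - v)) * (b / 2 + (u - v)).
    by apply: mulr_ge0; move: leb uv => ? /andP[]; lra.
  have h2 := sqr_ge0 (2 * v - u); have h3 := sqr_ge0 b.
  rewrite -subr_ge0; lra.
rewrite big_split/= -mulr_sumr -enorm_sqr sumr_const card_ord.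
rewrite -[X in _ + X]mulr_natl.
have [K EK] : exists K, K = 2 + n%:R * b ^+ 2 by eexists.
rewrite -EK in K2 K0 *; have -> : n%:R * b ^+ 2 = K - 2 by rewrite EK; ring.
have mm : 1 <= m ^+ 2 by rewrite exprn_ege1.
(* The target follows from [2 m^2 + (K - 2) <= K m^2 <= K^2 m^2], where [h1] and [h2] are the two
   inequalities. *)
have KK : K <= K ^+ 2 by rewrite expr2 ler_peMl//; lra.
have h1 : 0 <= (K - 2) * (m ^+ 2 - 1) by apply: mulr_ge0; lra.
have h2 : 0 <= (K ^+ 2 - K) * m ^+ 2 by apply: mulr_ge0; [lra|exact: sqr_ge0].
rewrite exprMn; lra.
Qed.

(** The ratio of the densities is the exponential of [|y|^2 - |x|^2]. Each coordinate contributes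
    [(v - u) * (v + u)], at most [l * (2 m + l)] with [m] the maximum of 1 and the norm of the
    center, hence at most [2 b + b^2] by [l m <= b] and [l <= b]. *)
Lemma gauss_comparable_cube :
  gauss_comparable (expR (n%:R * (2 * b + b ^+ 2))) (cube c l).
Proof.
move=> x y /cubeP xc /cubeP yc.
rewrite /gauss_pdf mulrCA ler_wpM2l ?powR_ge0// -expRD ler_expR.
rewrite -lerBlDr opprK addrC !enorm_sqr -sumrB.
apply: (@le_trans _ _ (\sum_(i < n) (2 * b + b ^+ 2))); last first.
  by rewrite sumr_const card_ord -[leLHS]mulr_natl.
apply: ler_sum => i _; have := xc i; have := yc i.
have := tnth_le_max1_enorm c i; rewrite ler_norml => cM.
move: (M1) (lM) cM; move: M => m m1 lm cM.
move: (tnth x i) (tnth y i) (tnth c i) cM => u v w /andP[? ?] /andP[? ?] /andP[? ?].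
have -> : v ^+ 2 - u ^+ 2 = (v - u) * (v + u) by ring.
have h1 : `|v - u| <= l by rewrite ler_norml; lra.
have h2 : `|v + u| <= 2 * m + l by rewrite ler_norml; lra.
rewrite (le_trans (ler_norm _))// normrM.
apply: (le_trans (ler_pM _ _ h1 h2)) => //.
have : l ^+ 2 <= b ^+ 2 by rewrite lerXn2r ?nnegrE// ?ltW// (lt_le_trans l0).
lra.
Qed.

End admissible.

Lemma expr_small (q r : R) : 0 <= q < 1 -> 0 < r -> exists k, q ^+ k <= r.
Proof.
move=> /andP[q0 q1] r0.
have : `|q| < 1 by rewrite ger0_norm.
move=> /cvg_expr /cvgr0Pnorm_le /(_ r r0) [k _ /(_ k (leqnn k))].
by rewrite /= ger0_norm ?exprn_ge0// => ?; exists k.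
Qed.

(** The constants are fixed before [f] and [Q], since the number of iterations depends only on [a],
    [b] and the dimension. Nonemptiness of [Q'] is recorded to make the later selection
    injective. *)
Lemma cubes_refine a b : 0 < a -> 0 < b -> exists C D : R,
  [/\ 0 < C, 0 < D &
   forall (f : n.-tuple R -> R) Q,
     gamma.-integrable [set: n.-tuple R] (EFin \o f) -> cubes b Q ->
     exists Q', [/\ cubes a Q', Q' `<=` Q, Q' !=set0,
       goscillation f Q <= C * goscillation f Q' &
       fine (gamma Q) <= D * fine (gamma Q')]].
Proof.
move=> a0 b0.
pose K := 2 + n%:R * b ^+ 2.
have K0 : 0 < K by rewrite /K ltr_pwDl// mulr_ge0// sqr_ge0.
pose E : R := expR (n%:R * (2 * b + b ^+ 2)).
have E0 : 0 < E by exact: expR_gt0.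
pose D : R := E ^+ 2 * 3 ^+ n.
have D0 : 0 < D by rewrite mulr_gt0 ?exprn_gt0.
pose C : R := 2 * #|{ffun 'I_n -> bool}|%:R * (1 + D).
have C0 : 0 < C.
  apply: mulr_gt0; last by rewrite addr_gt0.
  by rewrite mulr_gt0// ltr0n; apply/card_gt0P; exists [ffun=> true].
(* The shrinking must absorb both the ratio [b / a] of the parameters and the loss [K] in scale when
   the center moves from [c] to [c']. *)
have [||k kP] := @expr_small (2 / 3) (a / (b * K)); first lra.
  by rewrite divr_gt0// mulr_gt0.
have q0 : 0 < (2 / 3 : R) ^+ k by rewrite exprn_gt0// divr_gt0.
exists (C ^+ k), (D ^+ k); split; try exact: exprn_gt0.
move=> f _ fi [c [l [-> l0 lb]]].
have [c' [QQ o g]] := goscillation_subcube_iter k l0 E0 (gauss_comparable_cube l0 lb) fi.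
have ql0 : 0 < (2 / 3) ^+ k * l by rewrite mulr_gt0.
have c'Q := cube_center c' ql0.
exists (cube c' ((2 / 3) ^+ k * l)); split => //; last by exists c'.
exists c', ((2 / 3) ^+ k * l); split => //.
have := max1_enorm_cube l0 lb (QQ _ c'Q); rewrite -/K.
have M'0 : 0 < Num.max 1 (enorm c') by rewrite lt_max ltr01.
have M0 : 0 < Num.max 1 (enorm c) by rewrite lt_max ltr01.
move: lb; rewrite !gscaleE !ler_pdivlMr//.
move: M'0 M0; set M' := Num.max _ _; set M := Num.max _ _ => M'0 M0 lM M'M.
apply: (@le_trans _ _ ((2 / 3) ^+ k * (b * K))); last first.
  by rewrite -ler_pdivlMr// mulr_gt0.
rewrite -mulrA; apply: ler_wpM2l; first exact: ltW.
apply: (@le_trans _ _ (l * (K * M))); first by apply: ler_wpM2l => //; exact: ltW.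
by rewrite mulrCA mulrC; apply: ler_wpM2r => //; exact: ltW.
Qed.

End scale.

(** * Comparison of the constants and norms *)

Section comparison.
Variables (R : realType) (n : nat).
Local Notation gamma := (@gaussian R n).
Implicit Types (f : n.-tuple R -> R) (p a b : R).

Lemma JN_const_ge0 p a f : (0 <= JN_const p a f)%E.
Proof.
apply: le_ereal_sup_tmp.
exists ((\esum_(Q in set0) (gamma Q * (goscillation f Q `^ p)%:E)) `^ p^-1)%E.
  by exists set0 => //; split; [exact: countable0|exact: sub0set|move=> ? ? []].
exact: poweR_ge0.
Qed.

Lemma measurable_cubes a (Q : set (n.-tuple R)) : cubes a Q -> measurable Q.
Proof. by move=> [c [l [-> _ _]]]; exact: measurable_cube. Qed.

(** Each term of a packing for [b] is at most [D * C^p] times the term of its selected subcube: [D]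
    from the measure, [C^p] from the power of the oscillation. The outer root of order [p] then
    gives [K]. *)
Lemma JN_const_le p a b : 1 < p -> 0 < a -> 0 < b -> exists2 K : R, 0 < K &
  forall f, f \in Lfun gamma 1%E -> (JN_const p b f <= K%:E * JN_const p a f)%E.
Proof.
move=> p1 a0 b0; have p0 : 0 < p by exact: lt_trans p1.
have [C [D [C0 D0 CD]]] := @cubes_refine R n a b a0 b0.
exists ((D * C `^ p) `^ p^-1).
  by rewrite !(powR_gt0, mulr_gt0).
move=> f /Lfun1_integrable fi.
have /choice [r rP] : forall Q, exists Q', cubes b Q ->
    [/\ cubes a Q', Q' `<=` Q, Q' !=set0,
      goscillation f Q <= C * goscillation f Q' &
      fine (gamma Q) <= D * fine (gamma Q')].
  (* Outside the admissible cubes the selection takes the default value [set0], which is never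
     evaluated on a packing. *)
  move=> Q; case: (pselect (cubes b Q)) => Qb; last by exists set0.
  by have [Q' ?] := CD f Q fi Qb; exists Q'.
apply: ge_ereal_sup => _ [F [cF Fb tF] <-].
(* A point of a common selected subcube lies in both original cubes, which disjointness forces to be
   equal. *)
have rinj : set_inj F r.
  move=> P Q /set_mem FP /set_mem FQ rPQ.
  have [_ PP [x rx] _ _] := rP P (Fb P FP); have [_ QQ _ _ _] := rP Q (Fb Q FQ).
  by apply: tF => //; exists x; split; [exact: PP|apply: QQ; rewrite -rPQ].
have rF : JN_packing a (r @` F).
  split.
  - exact: sub_countable (card_image_le _ _) cF.
  - by move=> _ [Q FQ <-]; have [] := rP Q (Fb Q FQ).
  - move=> _ _ [P FP <-] [Q FQ <-] [x [xP xQ]].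
    have [_ PP _ _ _] := rP P (Fb P FP); have [_ QQ _ _ _] := rP Q (Fb Q FQ).
    by congr r; apply: tF => //; exists x; split; [exact: PP|exact: QQ].
apply: (@le_trans _ _ (((D * C `^ p)%:E *
    \esum_(Q in r @` F) (gamma Q * (goscillation f Q `^ p)%:E)) `^ p^-1)%E).
  apply: gt0_ler_poweR.
  - by rewrite invr_ge0 ltW.
  - by rewrite in_itv/= leey andbT; apply: esum_ge0 => Q _; rewrite mule_ge0// lee_fin powR_ge0.
  - by rewrite in_itv/= leey andbT mule_ge0 ?esum_ge0// => [|Q _];
      rewrite ?mule_ge0 ?lee_fin ?mulr_ge0 ?powR_ge0// ltW.
  (* Injectivity of [r] on [F] reindexes the sum over the image by [F], so that the terms compare
     one by one. *)
  rewrite esum_image// -esumZl; first last.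
  - by move=> Q; rewrite mule_ge0// lee_fin powR_ge0.
  - by rewrite mulr_ge0 ?powR_ge0// ltW.
  apply: le_esum => Q FQ; have [ra _ _ o g] := rP Q (Fb Q FQ).
  have mQ := measurable_cubes (Fb Q FQ); have mr := measurable_cubes ra.
  rewrite -(fineK (gamma_fin_num mQ)) -(fineK (gamma_fin_num mr)) -!EFinM lee_fin.
  have op : goscillation f Q `^ p <= C `^ p * goscillation f (r Q) `^ p.
    rewrite -powRM ?goscillation_ge0//; last exact: ltW.
    apply: ge0_ler_powR => //; rewrite ?nnegrE ?goscillation_ge0//.
    - exact: ltW.
    - by rewrite mulr_ge0 ?goscillation_ge0// ltW.
  by rewrite [leRHS]mulrACA; apply: ler_pM; rewrite ?fine_ge0 ?powR_ge0.
rewrite poweRM; first last.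
- by apply: esum_ge0 => Q _; rewrite mule_ge0// lee_fin powR_ge0.
- by rewrite lee_fin mulr_ge0 ?powR_ge0// ltW.
rewrite poweR_EFin; apply: lee_wpmul2l; first by rewrite lee_fin powR_ge0.
by apply: ereal_sup_ubound; exists (r @` F).
Qed.

Lemma JN_norm_le p a b : 1 < p -> 0 < a -> 0 < b -> exists2 K : R, 0 < K &
  forall f, f \in Lfun gamma 1%E -> (JN_norm p b f <= K%:E * JN_norm p a f)%E.
Proof.
move=> p1 a0 b0; have [K K0 KP] := JN_const_le p1 a0 b0.
(* The summand 1 serves the common [L^1] part of the norm, [K] the other part. *)
exists (1 + K); first by rewrite addr_gt0.
move=> f fL; rewrite /JN_norm ge0_muleDr ?Lnorm_ge0 ?JN_const_ge0//.
apply: leeD.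
  by rewrite -[leLHS]mul1e lee_wpmul2r ?Lnorm_ge0// lee_fin lerDl ltW.
apply: (le_trans (KP f fL)); rewrite lee_wpmul2r ?JN_const_ge0//.
by rewrite lee_fin lerDr.
Qed.

Lemma JN_subset p a b : 1 < p -> 0 < a -> 0 < b -> @JN R n p a `<=` JN p b.
Proof.
move=> p1 a0 b0 f [fL fa]; split => //; have [K K0 KP] := JN_const_le p1 a0 b0.
by rewrite (le_lt_trans (KP f fL))// lte_mul_pinfty// lee_fin ltW.
Qed.

End comparison.

Theorem proposition2p1 (R : realType) (d : nat) (p a1 a2 : R)
    (p_gt1 : 1 < p) (a1_gt0 : 0 < a1) (a2_gt0 : 0 < a2) :
  @JN R d p a1 = @JN R d p a2 /\
  exists m M : R, [/\ 0 < m, 0 < M &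
    forall f : d.-tuple R -> R, JN p a1 f ->
      (m%:E * JN_norm p a2 f <= JN_norm p a1 f)%E /\
      (JN_norm p a1 f <= M%:E * JN_norm p a2 f)%E].
Proof.
split; first by apply/seteqP; split; exact: JN_subset.
have [K K0 KP] := @JN_norm_le R d p a1 a2 p_gt1 a1_gt0 a2_gt0.
have [M M0 MP] := @JN_norm_le R d p a2 a1 p_gt1 a2_gt0 a1_gt0.
(* The lower constant inverts the bound of the norm for [a2] by the norm for [a1]; the upper one is
   the same bound with the parameters exchanged. *)
exists K^-1, M; split => //; first by rewrite invr_gt0.
by move=> f [fL _]; split; [rewrite lee_pdivrMl// KP|exact: MP].
Qed.
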